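(* The sceptical acceptance problem for bipolar ABA frameworks under admissible semantics is constant with answer `no': for every bipolar ABA framework $\mathcal{F}=(\mathcal{L},\mathcal{R},\mathcal{A},\overline{\phantom{a}})$ and every $a\in\mathcal{L}$, it is not the case that for every admissible extension $A$ of $\mathcal{F}$ there are $A'\subseteq A$ and $R\subseteq\mathcal{R}$ with a deduction $A'\vdash^{R}a$.
   Context: An ABA framework is a tuple $(\mathcal{L},\mathcal{R},\mathcal{A},\overline{\phantom{a}})$ where $\mathcal{L}$ is a set of sentences; $\mathcal{R}$ is a set of rules $\varphi_0\leftarrow\varphi_1,\dots,\varphi_m$ with $m\ge 0$ and all $\varphi_i\in\mathcal{L}$ (head $\varphi_0$, body $\varphi_1,\dots,\varphi_m$; for $m=0$ written $\varphi_0\leftarrow\top$ with $\top\notin\mathcal{L}$); $\mathcal{A}\subseteq\mathcal{L}$ is a non-empty set of assumptions; and $\overline{\phantom{a}}:\mathcal{A}\to\mathcal{L}$ is a total map ($\overline{\alpha}$ is the contrary of $\alpha$). It is bipolar iff every rule is of the form $\varphi\leftarrow\alpha$ with $\alpha\in\mathcal{A}$ and either $\varphi\in\mathcal{A}$ or $\varphi=\overline{\beta}$ for some $\beta\in\mathcal{A}$. A deduction $A\vdash^{R}\varphi$ for $\varphi\in\mathcal{L}$ supported by $A\subseteq\mathcal{A}$ and $R\subseteq\mathcal{R}$ is a finite tree with root labelled $\varphi$; leaves labelled by $\top$ or assumptions, with $A$ the set of all assumptions labelling leaves; and the children of each non-leaf labelled $\psi$ labelled by the elements of the body of some rule in $\mathcal{R}$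 with head $\psi$ (a single child $\top$ if the body is empty), with $R$ the set of all rules so used. For $A,B\subseteq\mathcal{A}$: $A$ attacks $B$ if there is a deduction $A'\vdash^{R}\overline{\beta}$ with $\beta\in B$, $A'\subseteq A$, $R\subseteq\mathcal{R}$. $Cl(A)=\{\alpha\in\mathcal{A}:\exists\, A'\vdash^{R}\alpha,\ A'\subseteq A,\ R\subseteq\mathcal{R}\}$; $A$ is closed iff $A=Cl(A)$; $A$ is conflict-free iff $A$ does not attack $A$; $A$ defends $\alpha\in\mathcal{A}$ iff $A$ attacks every closed $B\subseteq\mathcal{A}$ that attacks $\{\alpha\}$; $A$ defends $B$ iff it defends every $\beta\in B$. $A$ is admissible iff it is closed, conflict-free and defends itself. *)

(* Defs.v *)
From mathcomp Require Import all_boot.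
From mathcomp Require Import boolp classical_sets.

Set Implicit Arguments.
Unset Strict Implicit.
Unset Printing Implicit Defensive.

Local Open Scope classical_set_scope.

Record rule (L : Type) := Rule { head : L; body : seq L }.

(* The set of sentences is the whole type [L]. *)
Record aba (L : Type) := ABA {
  rules : set (rule L);
  assumptions : set L;
  assumptions_neq0 : assumptions !=set0;
  contrary : assumptions -> L }.

Definition bipolar (L : Type) (F : aba L) : Prop :=
  forall r : rule L, rules F r ->
    (exists2 a : L, assumptions F a & body r = [:: a]) /\
    (assumptions F (head r) \/ exists b : assumptions F, head r = contrary b).

(* Finite labelled trees. Labels live in [option L], with [None] standing for
   the symbol ⊤ outside [L]. An inner node stores the rule applied there, and
   its label is the head of that rule. *)
Inductive tree (L : Type) : Type :=
| Leaf (l : option L)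
| Node (r : rule L) (ts : seq (tree L)).

Definition label (L : Type) (t : tree L) : option L :=
  match t with
  | Leaf l => l
  | Node r _ => Some (head r)
  end.

Definition body_labels (L : Type) (r : rule L) : seq (option L) :=
  if body r is [::] then [:: None] else map Some (body r).

Fixpoint deduction_tree (L : Type) (F : aba L) (t : tree L) : Prop :=
  match t with
  | Leaf None => True
  | Leaf (Some a) => assumptions F a
  | Node r ts =>
      [/\ rules F r, map (@label L) ts = body_labels r
        & foldr (fun t P => deduction_tree F t /\ P) True ts]
  end.

Fixpoint tree_assumptions (L : Type) (t : tree L) : set L :=
  match t with
  | Leaf None => set0
  | Leaf (Some a) => [set a]
  | Node _ ts => foldr (fun t A => tree_assumptions t `|` A) set0 ts
  end.

Fixpoint tree_rules (L : Type) (t : tree L) : set (rule L) :=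
  match t with
  | Leaf _ => set0
  | Node r ts => [set r] `|` foldr (fun t R => tree_rules t `|` R) set0 ts
  end.

Definition deduction (L : Type) (F : aba L)
    (A : set L) (R : set (rule L)) (phi : L) : Prop :=
  exists t : tree L,
    [/\ deduction_tree F t, label t = Some phi,
        tree_assumptions t = A & tree_rules t = R].

Definition derivable (L : Type) (F : aba L) (A : set L) (phi : L) : Prop :=
  exists (A' : set L) (R : set (rule L)),
    [/\ A' `<=` A, R `<=` rules F & deduction F A' R phi].

Definition attacks (L : Type) (F : aba L) (A B : set L) : Prop :=
  exists2 b : assumptions F, B (val b) & derivable F A (contrary b).

Definition Cl (L : Type) (F : aba L) (A : set L) : set L :=
  [set a | assumptions F a /\ derivable F A a].

Definition is_closed (L : Type) (F : aba L) (A : set L) : Prop :=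
  A = Cl F A.

Definition conflict_free (L : Type) (F : aba L) (A : set L) : Prop :=
  ~ attacks F A A.

Definition defends (L : Type) (F : aba L) (A : set L) (a : L) : Prop :=
  forall B : set L, B `<=` assumptions F -> is_closed F B ->
    attacks F B [set a] -> attacks F A B.

Definition defends_set (L : Type) (F : aba L) (A B : set L) : Prop :=
  forall b : L, B b -> defends F A b.

Definition admissible (L : Type) (F : aba L) (A : set L) : Prop :=
  [/\ A `<=` assumptions F, is_closed F A, conflict_free F A
    & defends_set F A A].

(* Sceptical acceptance with respect to a family [E] of extensions of [F]. *)
Definition sceptically_accepted (L : Type) (F : aba L) (E : set (set L))
    (a : L) : Prop :=
  forall A : set L, E A -> derivable F A a.

(* Main.v *)
(* The rules of a bipolar framework have exactly one body element, an
   assumption, so no tree with a sentence at the root ends in ⊤ alone: every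
   deduction is supported by at least one assumption. Nothing is therefore
   derivable from the empty set, which makes the empty set admissible and at
   the same time a counterexample to the sceptical acceptance of any sentence. *)
From mathcomp Require Import all_boot.
From mathcomp Require Import boolp classical_sets.
Require Import Defs.

Local Open Scope classical_set_scope.

(** A one-element rule body forces a node to have exactly one child, again labelled by a sentence,
    so the hypothesis on the label passes down the branch. *)
Lemma bipolar_tree_assumptions_neq0 (L : Type) (F : aba L) (hF : bipolar F) :
  forall (t : tree L) (phi : L), deduction_tree F t -> label t = Some phi ->
  tree_assumptions t !=set0.
Proof.
(* [tree] is nested through [seq], hence the explicit [fix]; [IH] is applied to the only child. *)
fix IH 1 => -[[b|] phi //= _ _|r ts phi /= [Fr]]; first by exists b.
have [[b _ body_r] _] := hF r Fr; rewrite /body_labels body_r.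
case: ts => [//|t [|//]] [label_t] [ded_t _] _.
by rewrite /= setU0; apply: IH ded_t label_t.
Qed.

Lemma bipolar_not_derivable_set0 (L : Type) (F : aba L) (hF : bipolar F)
  (phi : L) : ~ derivable F set0 phi.
Proof.
move=> [A [R [A0 _ [t [ded_t label_t def_A _]]]]].
have [b tb] := @bipolar_tree_assumptions_neq0 L F hF t phi ded_t label_t.
by apply: (A0 b); rewrite -def_A.
Qed.

(** Conflict-freeness and defence hold vacuously; bipolarity enters through closedness, as it makes
    [Cl F set0] empty. *)
Lemma bipolar_admissible_set0 (L : Type) (F : aba L) (hF : bipolar F) :
  admissible F set0.
Proof.
split=> //; last by move=> [].
by apply/seteqP; split=> // b [_] /(bipolar_not_derivable_set0 _ _ hF).
Qed.

Theorem proposition3p14 (L : Type) (F : aba L) (hF : bipolar F) (a : L) :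
  ~ sceptically_accepted F (admissible F) a.
Proof.
move=> acc.
exact: bipolar_not_derivable_set0 hF _ (acc _ (bipolar_admissible_set0 _ _ hF)).
Qed.
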